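(* Let $X$ be a Banach space in which $C([0,1]^d)$ is continuously embedded and let $\mathcal K\subset X$ be compact. Let $\sigma$ be an $L$-Lipschitz sigmoidal function or $\mathrm{ReLU}$ (with $L=1$ in the latter case), and let the bound $w$ on the network parameters satisfy $w(n)\ge1$ and $LWw(n)\ge2$. (i) Let $E(\mathcal K,\Sigma_{n,\sigma}(w(n)))_X\lesssim[\log_2n]^\beta n^{-\alpha}$, $n\in\mathbb N$, for some $\alpha>0$ and $\beta\in\mathbb R$. - When $w(n)=Cn^\delta$, $C>0$, $\delta>0$, we have $\epsilon_n(\mathcal K)_X\lesssim n^{-\alpha/2}[\log_2n]^{\beta+\alpha/2}$, $n\in\mathbb N$. - When $w(n)=C2^{c'n^\nu}$, $C,c'>0$, $\nu\ge0$, we have $\epsilon_n(\mathcal K)_X\lesssim n^{-\alpha/(\nu+2)}[\log_2n]^{\beta}$, $n\in\mathbb N$. (ii) Let $E(\mathcal K,\Sigma_{n,\sigma}(w(n)))_X\lesssim2^{-cn}$, $n\in\mathbb N$, for some $c>0$. - When $w(n)=Cn^\delta$, $C,\delta>0$, there is a constant $c_1>0$ such that $\epsilon_n(\mathcal K)_X\lesssim2^{-c_1\sqrt n/\sqrt{\log_2n}}$, $n\in\mathbb N$. - When $w(n)=C2^{c'n^\nu}$, $C,c'>0$, $\nu\ge0$, there is a constant $c_1>0$ such that $\epsilon_n(\mathcal K)_X\lesssim2^{-c_1n^{1/(\nu+2)}}$, $n\in\mathbb N$.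
   Context: Deep neural networks. Fix $d\ge1$, a width $W\geq 2$, and an activation function $\sigma:\mathbb R\to\mathbb R$ which is either $\mathrm{ReLU}(t)=\max\{0,t\}$ (then $L:=1$), or an $L$-Lipschitz sigmoidal function; the only properties of the latter that are used are $|\sigma(t)|\le 1$ and $|\sigma(t_1)-\sigma(t_2)|\le L|t_1-t_2|$ for all $t,t_1,t_2\in\mathbb R$. Let $\bar\sigma:\mathbb R^W\to\mathbb R^W$ be $\sigma$ applied coordinatewise. For depth $n\ge1$ consider affine mappings $A^{(0)}:\mathbb R^d\to\mathbb R^W$, $A^{(\ell)}:\mathbb R^W\to\mathbb R^W$ ($\ell=1,\dots,n-1$), $A^{(n)}:\mathbb R^W\to\mathbb R$; let $y\in\mathbb R^{\tilde n}$ list in a fixed order all entries of their matrices and offset vectors, $\tilde n=W(d+1)+(n-1)W(W+1)+W+1$. Define on $[0,1]^d$ the function $\Phi_\sigma(y):=A^{(n)}\circ\bar\sigma\circ A^{(n-1)}\circ\cdots\circ\bar\sigma\circ A^{(0)}$. Put $\Sigma_{n,\sigma}(w(n)):=\{\Phi_\sigma(y):\|y\|_{\ell_\infty^{\tilde n}}\le w(n)\}$, $E(f,\Sigma_{n,\sigma}(w(n)))_X:=\inf_{\|y\|_{\ell_\infty^{\tilde n}}\le w(n)}\|f-\Phi_\sigma(y)\|_X$, and $E(\mathcal K,\Sigma_{n,\sigma}(w(n)))_X:=\sup_{f\in\mathcal K}E(f,\Sigma_{n,\sigma}(w(n)))_X$, $n\ge1$. The width $W$ is fixed while $n\to\infty$.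 Entropy numbers: $\epsilon_n(\mathcal K)_X$, $n\ge0$, is the infimum of all $\epsilon>0$ for which $\mathcal K$ is covered by $2^n$ balls of radius $\epsilon$ with centers in $X$. Asymptotic notation: for expressions $A,B$ depending on $n$, $A\lesssim B$ means that there is a constant $c>0$ independent of $n$ with $A\le cB$ as $n\to\infty$ (i.e. for all sufficiently large $n$, so that the logarithmic expressions are well defined). *)

(* Defs.v *)
From mathcomp Require Export all_boot all_order all_algebra.
From mathcomp Require Export all_classical all_reals all_analysis.
Export Order.TTheory GRing.Theory Num.Theory numFieldNormedType.Exports.

Set Implicit Arguments.
Unset Strict Implicit.
Unset Printing Implicit Defensive.

Local Open Scope classical_set_scope.
Local Open Scope ring_scope.

Definition relu (R : realType) (t : R) : R := Num.max 0 t.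

(* Sigmoidal functions enter only through these two properties; no limits at
   -oo and +oo are required. *)
Definition lipschitz_sigmoidal (R : realType) (L : R) (sigma : R -> R) : Prop :=
  (forall t, `|sigma t| <= 1) /\
  (forall t1 t2, `|sigma t1 - sigma t2| <= L * `|t1 - t2|).

Definition admissible_activation (R : realType) (L : R) (sigma : R -> R) : Prop :=
  (sigma = @relu R /\ L = 1) \/ lipschitz_sigmoidal L sigma.

(* An affine map R^p -> R^q is stored as its augmented matrix [b | A], whose
   column 0 is the offset vector b. *)
Definition affine_map (R : realType) (q p : nat) (A : 'M[R]_(q, 1 + p))
    (x : 'cV[R]_p) : 'cV[R]_q :=
  rsubmx A *m x + lsubmx A.

Definition nparam (d W n : nat) : nat :=
  (W * (1 + d) + n.-1 * (W * (1 + W)) + 1 * (1 + W))%N.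

Section Network.
Context {R : realType} {d W n : nat}.
Implicit Type y : 'rV[R]_(nparam d W n).

Definition layer_in y : 'M[R]_(W, 1 + d) := vec_mx (lsubmx (lsubmx y)).

(* [layer_mid y l] is the affine map A^(l+1), for l + 1 = 1, ..., n - 1. *)
Definition layer_mid y (l : 'I_n.-1) : 'M[R]_(W, 1 + W) :=
  vec_mx (row l (vec_mx (rsubmx (lsubmx y)))).

Definition layer_out y : 'M[R]_(1, 1 + W) := vec_mx (rsubmx y).

(* Phi_sigma(y); only its values on the unit cube matter. *)
Definition network (sigma : R -> R) y (x : 'cV[R]_d) : R :=
  let h := foldl (fun z l => affine_map (layer_mid y l) (map_mx sigma z))
             (affine_map (layer_in y) x) (enum 'I_n.-1) in
  affine_map (layer_out y) (map_mx sigma h) 0 0.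

End Network.

Definition unit_cube (R : realType) (d : nat) : set 'cV[R]_d :=
  [set x | forall i, 0 <= x i 0 <= 1].

Definition cube_norm (R : realType) (d : nat) (f : 'cV[R]_d -> R) : R :=
  sup [set `|f x| | x in @unit_cube R d].

(* Elements of C([0,1]^d) are represented by functions on R^d that are
   continuous on the cube, two such functions being identified when they agree
   there; the last two clauses make iota well defined and injective on the
   quotient. *)
Definition continuous_embedding (R : realType) (d : nat) (X : normedModType R)
    (iota : ('cV[R]_d -> R) -> X) : Prop :=
  [/\ forall (a : R) (f g : 'cV[R]_d -> R),
        {within @unit_cube R d, continuous f} ->
        {within @unit_cube R d, continuous g} ->
        iota (fun x => a * f x + g x) = a *: iota f + iota g,
      exists M : R, forall f : 'cV[R]_d -> R,
        {within @unit_cube R d, continuous f} ->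
        `|iota f| <= M * cube_norm f
    & forall f g : 'cV[R]_d -> R,
        {within @unit_cube R d, continuous f} ->
        {within @unit_cube R d, continuous g} ->
        iota f = iota g -> {in @unit_cube R d, f =1 g}].

(* The library norm on row vectors is the maximum of the absolute values of the
   entries, i.e. the l_infinity norm. *)
Definition network_set (R : realType) (d W n : nat) (sigma : R -> R) (r : R) :
    set ('cV[R]_d -> R) :=
  [set network sigma y | y in [set y : 'rV[R]_(nparam d W n) | `|y| <= r]].

Definition approx_error (R : realType) (d : nat) (X : normedModType R)
    (iota : ('cV[R]_d -> R) -> X) (f : X) (S : set ('cV[R]_d -> R)) : \bar R :=
  ereal_inf [set (`|f - iota g|)%:E | g in S].

Definition class_error (R : realType) (d : nat) (X : normedModType R)
    (iota : ('cV[R]_d -> R) -> X) (K : set X) (S : set ('cV[R]_d -> R)) : \bar R :=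
  ereal_sup [set approx_error iota f S | f in K].

Definition entropy_number (R : realType) (X : normedModType R) (K : set X)
    (n : nat) : \bar R :=
  ereal_inf [set e%:E | e in [set e : R | 0 < e /\
    exists c : 'I_(2 ^ n) -> X, K `<=` \bigcup_i ball (c i) e]].

Definition lesssim (R : realType) (A : nat -> \bar R) (B : nat -> R) : Prop :=
  exists c : R, 0 < c /\ \forall n \near \oo, (A n <= (c * B n)%:E)%E.

Definition log2 (R : realType) (x : R) : R := ln x / ln 2.

(* Main.v *)
(* Networks are Lipschitz in their parameters: if all parameters are bounded by
   a and Q is a suitable multiple of a, moving every parameter by at most eta
   moves the output by at most eta * Q ^ (2 (n + 1)). A grid on the parameter
   cube with 2 ^ p + 1 points per coordinate therefore yields centers of balls
   covering K as soon as 2 ^ p exceeds Q ^ (2 (n + 2)) / eps, where eps bounds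
   the approximation error. With log2 (w n) = O(g n), this costs O(n^2 g n) bits,
   since there are O(n) parameters and p = O(n g n); so the entropy number of
   index O(n^2 g n) is bounded by a multiple of the error at depth n. Inverting
   m = n^2 log2 n, resp. m = n ^ (nu + 2), gives the four rates. *)
Require Import Defs.
From mathcomp Require Import ring lra.

Set Implicit Arguments.
Unset Strict Implicit.
Unset Printing Implicit Defensive.

Local Open Scope classical_set_scope.
Local Open Scope ring_scope.

(** * Maximum norms of matrix products and affine maps *)

Section MatrixNorm.
Context {R : realType}.

Lemma mx_norm_leP (m n : nat) (A : 'M[R]_(m, n)) (r : R) : 0 <= r ->
  reflect (forall i j, `|A i j| <= r) (`|A| <= r).
Proof.
move=> r0; rewrite [`|A|]/Num.Def.normr/= mx_normrE; apply: (iffP idP).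
  by move=> /bigmax_leP[_ H] i j; exact: (H (i, j)).
by move=> H; apply/bigmax_leP; split=> // -[i j] _; exact: H.
Qed.

Lemma mx_entry_le_norm (m n : nat) (A : 'M[R]_(m, n)) i j : `|A i j| <= `|A|.
Proof. by apply/mx_norm_leP. Qed.

Lemma norm_mulmx (m n p : nat) (A : 'M[R]_(m, n)) (B : 'M[R]_(n, p)) :
  `|A *m B| <= n%:R * (`|A| * `|B|).
Proof.
apply/mx_norm_leP => [|i j]; first by rewrite !mulr_ge0.
rewrite mxE (le_trans (ler_norm_sum _ _ _))//.
apply: (@le_trans _ _ (\sum_(k < n) (`|A| * `|B|))).
  by apply: ler_sum => k _; rewrite normrM ler_pM ?mx_entry_le_norm.
by rewrite sumr_const card_ord mulr_natl.
Qed.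

Lemma norm_affine_map (q p : nat) (A : 'M[R]_(q, 1 + p)) (x : 'cV[R]_p) :
  `|affine_map A x| <= `|A| * (p%:R * `|x| + 1).
Proof.
have rA : `|rsubmx A| <= `|A|.
  by apply/mx_norm_leP => // i j; rewrite mxE mx_entry_le_norm.
have lA : `|lsubmx A| <= `|A|.
  by apply/mx_norm_leP => // i j; rewrite mxE mx_entry_le_norm.
rewrite (le_trans (ler_normD _ _))// mulrDr mulr1 lerD//.
rewrite (le_trans (norm_mulmx _ _))// mulrCA ler_wpM2r ?mulr_ge0//.
Qed.

(** The difference splits into the linear part of [A] applied to [x - x'] and the affine map
    [A - A'] applied to [x'], so a size bound is needed only for [A] and for [x']. *)
Lemma norm_affine_mapB (q p : nat) (A A' : 'M[R]_(q, 1 + p)) (x x' : 'cV[R]_p) :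
  `|affine_map A x - affine_map A' x'| <=
  `|A| * (p%:R * `|x - x'|) + `|A - A'| * (p%:R * `|x'| + 1).
Proof.
have -> : affine_map A x - affine_map A' x' =
    rsubmx A *m (x - x') + affine_map (A - A') x'.
  rewrite /affine_map mulmxBr !linearB/= mulmxBl.
  by rewrite opprD addrACA [in RHS]addrA subrKA.
rewrite (le_trans (ler_normD _ _))// lerD ?norm_affine_map//.
rewrite (le_trans (norm_mulmx _ _))// mulrCA ler_wpM2r ?mulr_ge0//.
by apply/mx_norm_leP => // i j; rewrite mxE mx_entry_le_norm.
Qed.

Lemma dist_le_continuous (V V' : normedModType R) (f : V -> V') (k : R) :
  (forall x y, `|f x - f y| <= k * `|x - y|) -> continuous f.
Proof.
move=> fk x; apply/cvgrPdist_lt => e e0.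
have k0 : 0 < `|k| + 1 by rewrite ltr_pwDr.
near=> y; rewrite (le_lt_trans (fk _ _))//.
apply: (@le_lt_trans _ _ ((`|k| + 1) * `|x - y|)).
  by rewrite ler_wpM2r// (le_trans (ler_norm _))// lerDl.
rewrite mulrC -ltr_pdivlMr//; near: y.
by apply: cvgr_dist_lt; [exact: cvg_id|rewrite divr_gt0].
Unshelve. all: by end_near. Qed.

Lemma affine_map_continuous (q p : nat) (A : 'M[R]_(q, 1 + p)) :
  continuous (affine_map A).
Proof.
apply: (@dist_le_continuous _ _ _ (`|A| * p%:R)) => x y.
by rewrite (le_trans (norm_affine_mapB _ _ _ _))// subrr normr0 mul0r addr0 mulrA.
Qed.

End MatrixNorm.

(** * Growth of networks and Lipschitz dependence on the parameters *)

Section NetworkLipschitz.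
Context {R : realType} (sigma : R -> R) (L : R).
(** ReLU satisfies this through [|sigma t| <= |t|], a sigmoidal function through [|sigma t| <= 1];
    the restriction [1 <= r] lets one condition cover both. *)
Hypothesis sigma_growth : forall t r, 1 <= r -> `|t| <= r -> `|sigma t| <= r.
Hypothesis sigma_lip : forall t u, `|sigma t - sigma u| <= L * `|t - u|.
Hypothesis L_gt0 : 0 < L.

Lemma norm_map_activation (m : nat) (z : 'cV[R]_m) (r : R) :
  1 <= r -> `|z| <= r -> `|map_mx sigma z| <= r.
Proof.
move=> r1 zr; have r0 : 0 <= r by rewrite (le_trans ler01).
apply/mx_norm_leP => // i j; rewrite mxE sigma_growth//.
by rewrite (le_trans (mx_entry_le_norm _ _ _)).
Qed.

Lemma norm_map_activationB (m : nat) (z z' : 'cV[R]_m) :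
  `|map_mx sigma z - map_mx sigma z'| <= L * `|z - z'|.
Proof.
apply/mx_norm_leP => [|i j]; first by rewrite mulr_ge0// ltW.
rewrite !mxE (le_trans (sigma_lip _ _))// ler_wpM2l ?(ltW L_gt0)//.
by have := mx_entry_le_norm (z - z') i j; rewrite !mxE.
Qed.

Section Layers.
Context (a Q eta : R).
Hypotheses (a1 : 1 <= a) (Q2 : 2 <= Q) (eta0 : 0 <= eta).

(** Since [1 <= Q ^+ k], the offset is absorbed by [p * Q ^+ k + 1 <= (p + 1) * Q ^+ k], and a layer
    costs a single factor [Q]. *)
Lemma norm_layer (q p k : nat) (A : 'M[R]_(q, 1 + p)) (z : 'cV[R]_p) :
  a * p.+1%:R <= Q -> `|A| <= a -> `|z| <= Q ^+ k ->
  `|affine_map A z| <= Q ^+ k.+1.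
Proof.
move=> aQ Aa zQ; have Q1 : 1 <= Q ^+ k by rewrite exprn_ege1// (le_trans _ Q2)// ler1n.
rewrite (le_trans (norm_affine_map _ _))//.
apply: (@le_trans _ _ (a * (p.+1%:R * Q ^+ k))).
  rewrite ler_pM ?addr_ge0 ?mulr_ge0//.
  by rewrite -natr1 mulrDl mul1r lerD// ler_wpM2l.
by rewrite mulrA exprS ler_wpM2r//; lra.
Qed.

(* Bounding the difference by [Q ^+ k.*2] rather than [k * Q ^+ k] absorbs the
   factors k and 2 that arise when adding the two error terms of a layer. *)
Lemma norm_layerB (q p k : nat) (A A' : 'M[R]_(q, 1 + p)) (z z' : 'cV[R]_p) :
  a * p.+1%:R * (1 + L) <= Q ->
  `|A| <= a -> `|A - A'| <= eta ->
  `|z'| <= Q ^+ k -> `|z - z'| <= L * (eta * Q ^+ k.*2) ->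
  `|affine_map A z - affine_map A' z'| <= eta * Q ^+ k.+1.*2.
Proof.
move=> aQ Aa AA zQ zz.
have Q0 : 0 <= Q by rewrite (le_trans _ Q2).
have Q1 : 1 <= Q ^+ k by rewrite exprn_ege1// (le_trans _ Q2)// ler1n.
have QQ : Q ^+ k <= Q ^+ k.*2.
  by rewrite ler_weXn2l -?addnn ?leq_addr// (le_trans _ Q2)// ler1n.
have p0 : 1 <= p.+1%:R :> R by rewrite ler1n.
have pQ : a * p.+1%:R * L <= Q.
  apply: le_trans aQ; rewrite ler_wpM2l ?lerDr ?mulr_ge0// ?(le_trans _ a1)//.
have pQ' : p.+1%:R <= Q.
  apply: le_trans aQ; apply: (@le_trans _ _ (a * p.+1%:R)).
    by rewrite ler_peMl// (le_trans _ p0).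
  by rewrite ler_peMr ?mulr_ge0 ?lerDl// ?(ltW L_gt0)// (le_trans _ a1).
have E0 : 0 <= eta * Q ^+ k.*2 by rewrite mulr_ge0 ?exprn_ge0.
rewrite (le_trans (norm_affine_mapB _ _ _ _))//.
apply: (@le_trans _ _ (Q * (eta * Q ^+ k.*2) + eta * (Q * Q ^+ k.*2))).
  apply: lerD.
    apply: (@le_trans _ _ (a * p.+1%:R * L * (eta * Q ^+ k.*2))); last first.
      by rewrite ler_wpM2r.
    by rewrite -!mulrA ler_pM ?mulr_ge0// ler_pM// ler_nat.
  rewrite ler_pM ?addr_ge0 ?mulr_ge0//.
  apply: (@le_trans _ _ (p.+1%:R * Q ^+ k)).
    by rewrite -natr1 mulrDl mul1r lerD// ler_wpM2l.
  by rewrite ler_pM// (le_trans ler01).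
rewrite doubleS !exprS mulrCA -mulrDr ler_wpM2l//.
rewrite -mulr2n -[X in X <= _]mulr_natl ler_wpM2r// mulr_ge0 ?exprn_ge0//.
Qed.

(** Induction on the list with [k], [z] and [z'] free: [foldl] passes the state through one layer
    before recursing, so the tail starts at exponent [k.+1]. The size of the primed state is carried
    along because the difference bound of the next layer uses it. *)
Lemma norm_foldl_layers (I : Type) (W k : nat) (s : seq I)
    (A A' : I -> 'M[R]_(W, 1 + W)) (z z' : 'cV[R]_W) :
  a * W.+1%:R * (1 + L) <= Q ->
  (forall i, `|A i| <= a) -> (forall i, `|A' i| <= a) ->
  (forall i, `|A i - A' i| <= eta) ->
  `|z'| <= Q ^+ k -> `|z - z'| <= eta * Q ^+ k.*2 ->
  let F B z := foldl (fun z l => affine_map (B l) (map_mx sigma z)) z s in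
  `|F A' z'| <= Q ^+ (k + size s) /\
  `|F A z - F A' z'| <= eta * Q ^+ (k + size s).*2.
Proof.
move=> WQ Aa A'a AA.
have WQ' : a * W.+1%:R <= Q.
  apply: le_trans WQ; rewrite ler_peMr ?mulr_ge0 ?lerDl// ?(ltW L_gt0)//.
  by rewrite (le_trans _ a1).
elim: s k z z' => [|i s IH] k z z' zQ zz /=; first by rewrite addn0.
rewrite addnS -addSn; apply: IH.
  apply: norm_layer => //; apply: norm_map_activation => //.
  by rewrite exprn_ege1// (le_trans _ Q2)// ler1n.
apply: norm_layerB => //.
  by apply: norm_map_activation => //; rewrite exprn_ege1// (le_trans _ Q2)// ler1n.
by rewrite (le_trans (norm_map_activationB _ _))// ler_wpM2l// ltW.
Qed.

End Layers.

Section ParamDependence.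
Context {d W n : nat}.
Implicit Types y : 'rV[R]_(nparam d W n).

Lemma layer_inB y y' : layer_in y - layer_in y' = layer_in (y - y').
Proof. by rewrite /layer_in !linearB. Qed.

Lemma layer_midB y y' l : layer_mid y l - layer_mid y' l = layer_mid (y - y') l.
Proof. by rewrite /layer_mid !linearB. Qed.

Lemma layer_outB y y' : layer_out y - layer_out y' = layer_out (y - y').
Proof. by rewrite /layer_out !linearB. Qed.

Lemma norm_layer_in y : `|layer_in y| <= `|y|.
Proof. by apply/mx_norm_leP => // i j; rewrite !mxE mx_entry_le_norm. Qed.

Lemma norm_layer_mid y l : `|layer_mid y l| <= `|y|.
Proof. by apply/mx_norm_leP => // i j; rewrite !mxE mx_entry_le_norm. Qed.

Lemma norm_layer_out y : `|layer_out y| <= `|y|.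
Proof. by apply/mx_norm_leP => // i j; rewrite !mxE mx_entry_le_norm. Qed.

(** A single [Q] serves all layers because [d + W] dominates both input dimensions [d] and [W]. The
    [n + 1] affine maps raise the exponent one by one from 0 at the input. *)
Lemma network_lipschitz (a Q eta : R) y y' (x : 'cV[R]_d) :
  (0 < n)%N -> 1 <= a -> 2 <= Q -> a * (d + W).+1%:R * (1 + L) <= Q ->
  `|y| <= a -> `|y'| <= a -> `|y - y'| <= eta -> unit_cube x ->
  `|network sigma y x - network sigma y' x| <= eta * Q ^+ n.+1.*2.
Proof.
move=> n0 a1 Q2 aQ ya y'a yy xc.
have e0 : 0 <= eta by apply: le_trans yy.
have x1 : `|x| <= 1.
  apply/mx_norm_leP => // i j; rewrite ord1.
  by have /andP[? ?] := xc i; rewrite ger0_norm.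
have pQ p : (p <= d + W)%N -> a * p.+1%:R * (1 + L) <= Q.
  move=> pdW; apply: le_trans aQ; rewrite ler_wpM2r ?addr_ge0 ?(ltW L_gt0)//.
  by rewrite ler_wpM2l ?ler_nat// (le_trans _ a1).
have pQ' p : (p <= d + W)%N -> a * p.+1%:R <= Q.
  move=> /pQ; apply: le_trans; rewrite ler_peMr ?mulr_ge0 ?lerDl//.
    by rewrite (le_trans _ a1).
  by rewrite ltW.
have dQ : (d <= d + W)%N by rewrite leq_addr.
have WQ : (W <= d + W)%N by rewrite leq_addl.
have [] := @norm_foldl_layers a Q eta a1 Q2 e0 _ W 1 (enum 'I_n.-1)
  (layer_mid y) (layer_mid y') (affine_map (layer_in y) x)
  (affine_map (layer_in y') x).
- exact: pQ.
- by move=> i; rewrite (le_trans (norm_layer_mid _ _)).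
- by move=> i; rewrite (le_trans (norm_layer_mid _ _)).
- by move=> i; rewrite layer_midB (le_trans (norm_layer_mid _ _)).
(* Points of the cube have norm at most [1 = Q ^+ 0], which starts the count at [k = 0]. *)
- apply: (@norm_layer a Q Q2 _ _ 0) => //; first exact: pQ'.
  by rewrite (le_trans (norm_layer_in _)).
- apply: (@norm_layerB a Q eta a1 Q2 e0 _ _ 0) => //; first exact: pQ.
  + by rewrite (le_trans (norm_layer_in _)).
  + by rewrite layer_inB (le_trans (norm_layer_in _)).
  + by rewrite subrr normr0 !mulr_ge0 ?(ltW L_gt0).
rewrite size_enum_ord add1n prednK// => Hb Hd.
rewrite /network; set h := foldl _ _ _; set h' := foldl _ _ _.
have := mx_entry_le_norm (affine_map (layer_out y) (map_mx sigma h) -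
  affine_map (layer_out y') (map_mx sigma h')) 0 0.
rewrite !mxE => /le_trans; apply.
apply: (norm_layerB a1 Q2 e0) => //; first exact: pQ.
- by rewrite (le_trans (norm_layer_out _)).
- by rewrite layer_outB (le_trans (norm_layer_out _)).
- by apply: norm_map_activation => //; rewrite exprn_ege1// (le_trans _ Q2)// ler1n.
- by rewrite (le_trans (norm_map_activationB _ _))// ler_wpM2l// ltW.
Qed.

Lemma network_continuous y : continuous (network sigma y).
Proof.
have mapC m : continuous (fun z : 'cV[R]_m => map_mx sigma z).
  exact: dist_le_continuous (@norm_map_activationB m).
(* The inner map [f] is arbitrary because [foldl] composes each new layer into the starting
   state. *)
have foldC (s : seq 'I_n.-1) (f : 'cV[R]_d -> 'cV[R]_W) : continuous f ->
    continuous (fun x => foldl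
      (fun z l => affine_map (layer_mid y l) (map_mx sigma z)) (f x) s).
  elim: s f => // l s IH f fC /=; apply: IH => x.
  apply: continuous_comp; last exact: affine_map_continuous.
  by apply: continuous_comp; [exact: fC|exact: mapC].
have outC : continuous (fun x => affine_map (layer_out y) (map_mx sigma (foldl
    (fun z l => affine_map (layer_mid y l) (map_mx sigma z))
    (affine_map (layer_in y) x) (enum 'I_n.-1)))).
  move=> x; apply: continuous_comp; last exact: affine_map_continuous.
  apply: continuous_comp; last exact: mapC.
  exact/foldC/affine_map_continuous.
by move=> x; exact: (continuous_comp (outC x)
  (@coord_continuous _ _ _ 0 0 _)).
Qed.

End ParamDependence.
End NetworkLipschitz.

(** * Parameter grids and the coverings of [K] that they induce *)

Lemma interval_grid (R : realType) (a : R) (N : nat) : 0 < a -> (0 < N)%N ->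
  exists g : 'I_N.+1 -> R, (forall k, `|g k| <= a) /\
    forall t, `|t| <= a -> exists k, `|t - g k| <= 2 * a / N%:R.
Proof.
move=> a0 N0; pose h := 2 * a / N%:R.
have h0 : 0 < h by rewrite divr_gt0 ?mulr_gt0 ?ltr0n.
have hN : N%:R * h = 2 * a by rewrite /h mulrC divfK// pnatr_eq0 -lt0n.
exists (fun k => - a + k%:R * h); split.
  move=> k; have kh : k%:R * h <= 2 * a.
    by rewrite -hN ler_wpM2r ?(ltW h0)// ler_nat -ltnS.
  have kh0 : 0 <= k%:R * h by rewrite mulr_ge0 ?(ltW h0).
  by rewrite ler_norml; apply/andP; split; lra.
move=> t; rewrite ler_norml => /andP[at_ ta].
pose s := (t + a) / h.
have s0 : 0 <= s by rewrite divr_ge0 ?(ltW h0)//; lra.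
have sh : s * h = t + a by rewrite /s divfK// gt_eqF.
(* Rounding [t] down to the grid gives an index at most [N], attained at [t = a]; hence [N + 1]
   points. *)
have kN : (Num.truncn s < N.+1)%N.
  rewrite ltnS -(ler_nat R) (@le_trans _ _ s)//; first by rewrite truncn_le.
  by rewrite -(ler_pM2r h0) sh hN; lra.
exists (Ordinal kN) => /=.
have /andP[ks sk] := truncn_itv s0.
have -> : t - (- a + (Num.truncn s)%:R * h) = (s - (Num.truncn s)%:R) * h.
  by rewrite mulrBl sh; ring.
rewrite ger0_norm; last by apply: mulr_ge0; [rewrite subr_ge0|exact: ltW].
by rewrite ler_piMl ?(ltW h0)// lerBlDr addrC natr1 ltW.
Qed.

Section Entropy.
Context {R : realType} {X : normedModType R} (K : set X).

Lemma entropy_number_le_card (T : finType) (c : T -> X) (e : R) (m : nat) :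
  0 < e -> (#|T| <= 2 ^ m)%N -> K `<=` \bigcup_i ball (c i) e ->
  (entropy_number K m <= e%:E)%E.
Proof.
move=> e0 Tm Kc; apply: ereal_inf_lbound; exists e => //; split=> //.
(* The default 0 pads the list of centers when [T] has fewer than [2 ^ m] elements. *)
exists (fun i : 'I_(2 ^ m) => nth 0 [seq c t | t <- enum T] i) => f /Kc[t _ ft].
have tm : (index t (enum T) < 2 ^ m)%N.
  by rewrite (leq_trans _ Tm)// cardE index_mem mem_enum.
exists (Ordinal tm) => //=.
by rewrite (nth_map t) ?index_mem ?mem_enum// nth_index ?mem_enum.
Qed.

End Entropy.

Section Embedding.
Context {R : realType} {d : nat} {X : normedModType R}.
Variable iota : ('cV[R]_d -> R) -> X.
Hypothesis iota_emb : continuous_embedding iota.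

(** Linearity turns the bound on [iota] into one for differences, and a pointwise bound on the cube
    controls the supremum [cube_norm]. *)
Lemma continuous_embedding_lipschitz : exists2 M : R, 1 <= M &
  forall (f g : 'cV[R]_d -> R) (e : R),
    {within @unit_cube R d, continuous f} ->
    {within @unit_cube R d, continuous g} ->
    (forall x, unit_cube x -> `|f x - g x| <= e) ->
    `|iota f - iota g| <= M * e.
Proof.
have [iotaL [M iotaM] _] := iota_emb.
exists (1 + `|M|); first by rewrite lerDl.
move=> f g e fC gC fg.
(* A point of the cube is needed to see that [e] is nonnegative and that the supremum runs over a
   nonempty set. *)
have cube0 : @unit_cube R d 0 by move=> i; rewrite mxE lexx ler01.
have e0 : 0 <= e by rewrite (le_trans _ (fg _ cube0)).
have fgC : {within @unit_cube R d, continuous (fun x => -1 * g x + f x)}.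
  move=> x; apply: cvgD; last exact: fC.
  by apply: cvgM; [exact: cvg_cst|exact: gC].
have -> : iota f - iota g = iota (fun x => -1 * g x + f x).
  by rewrite iotaL// scaleN1r addrC.
rewrite (le_trans (iotaM _ fgC))//.
have H : cube_norm (fun x => -1 * g x + f x) <= e.
  apply: ge_sup; first by exists `|-1 * g 0 + f 0|, 0.
  by move=> _ [x xc <-]; rewrite mulN1r addrC fg.
have H0 : 0 <= cube_norm (fun x => -1 * g x + f x).
  apply: (@le_trans _ _ `|-1 * g 0 + f 0|) => //.
  apply: ub_le_sup; last by exists 0.
  by exists e => _ [x xc <-]; rewrite mulN1r addrC fg.
apply: (@le_trans _ _ ((1 + `|M|) * cube_norm (fun x => -1 * g x + f x))).
  by rewrite ler_wpM2r// (le_trans (ler_norm _))// lerDr.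
by rewrite ler_wpM2l.
Qed.

End Embedding.

Section Covering.
Context {R : realType} {d W n : nat} {X : normedModType R}.
Variables (iota : ('cV[R]_d -> R) -> X) (sigma : R -> R) (L : R).
Hypothesis sigma_growth : forall t r, 1 <= r -> `|t| <= r -> `|sigma t| <= r.
Hypothesis sigma_lip : forall t u, `|sigma t - sigma u| <= L * `|t - u|.
Hypothesis L_gt0 : 0 < L.
Variable M : R.
Hypothesis M1 : 1 <= M.
Hypothesis iotaM : forall (f g : 'cV[R]_d -> R) (e : R),
    {within @unit_cube R d, continuous f} ->
    {within @unit_cube R d, continuous g} ->
    (forall x, unit_cube x -> `|f x - g x| <= e) ->
    `|iota f - iota g| <= M * e.

(** The radius [2 * e] is spent in two halves: [e] for approximating [f] by some network, [e] for
    rounding the parameters of that network to the grid. *)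
Lemma entropy_number_network (K : set X) (a Q e : R) (p m : nat) :
  (0 < n)%N -> 1 <= a -> 2 <= Q -> a * (d + W).+1%:R * (1 + L) <= Q ->
  0 < e -> M * Q ^+ n.+2.*2 <= e * 2 ^+ p ->
  (nparam d W n * p.+1 <= m)%N ->
  (class_error iota K (@network_set R d W n sigma a) < e%:E)%E ->
  (entropy_number K m <= (2 * e)%:E)%E.
Proof.
move=> n0 a1 Q2 aQ e0 Qe pm Ke.
have a0 : 0 < a by rewrite (lt_le_trans _ a1).
have p0 : (0 < 2 ^ p)%N by rewrite expn_gt0.
have [g [ga gt]] := interval_grid a0 p0.
pose y (k : {ffun 'I_(nparam d W n) -> 'I_(2 ^ p).+1}) : 'rV[R]_(nparam d W n) :=
  \row_j g (k j).
have ya k : `|y k| <= a.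
  by apply/mx_norm_leP => [|i j]; [exact: ltW|rewrite mxE].
apply: (@entropy_number_le_card _ _ _ _ (fun k => iota (network sigma (y k)))).
- by rewrite mulr_gt0.
- rewrite card_ffun !card_ord (leq_trans _ (leq_pexp2l _ pm))//.
  (* The extra grid point costs one more bit per coordinate, hence [p.+1] in the budget. *)
  have pS : ((2 ^ p).+1 <= 2 ^ p.+1)%N by rewrite expnS mul2n -addnn -addn1 leq_add.
  rewrite mulnC expnM; elim: (nparam _ _ _) => // k IH.
  by rewrite expnS [leqRHS]expnS leq_mul.
move=> f Kf.
(* The infimum need not be attained; the strict inequality still provides a network within [e]. *)
have /ereal_inf_lt[_ [_ [z za <-] <-]] :
    (approx_error iota f (@network_set R d W n sigma a) < e%:E)%E.
  by apply: le_lt_trans Ke; apply: ereal_sup_ubound; exists f.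
rewrite lte_fin => fz.
have /choice[k zk] : forall j, exists k, `|z 0 j - g k| <= 2 * a / (2 ^ p)%:R.
  by move=> j; apply: gt; rewrite (le_trans (mx_entry_le_norm _ _ _)).
exists (finfun k) => //; rewrite -ball_normE/= distrC.
have zy : `|z - y (finfun k)| <= 2 * a / (2 ^ p)%:R.
  apply/mx_norm_leP => [|i j].
    by rewrite divr_ge0 ?mulr_ge0 ?(ltW a0).
  by rewrite !mxE ord1 ffunE.
have Q0 : 0 < Q by rewrite (lt_le_trans _ Q2).
have aQ' : a <= Q.
  by rewrite (le_trans _ aQ)// -mulrA ler_peMr ?(ltW a0)// mulr_ege1 ?ler1n ?lerDl ?ltW.
have : `|iota (network sigma z) - iota (network sigma (y (finfun k)))| <= e.
  apply: (@le_trans _ _ (M * (2 * a / (2 ^ p)%:R * Q ^+ n.+1.*2))).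
    apply: iotaM.
    - exact/continuous_subspaceT/(network_continuous sigma_lip L_gt0).
    - exact/continuous_subspaceT/(network_continuous sigma_lip L_gt0).
    - move=> x xc.
      exact: (network_lipschitz sigma_growth sigma_lip L_gt0 n0 a1 Q2 aQ).
  rewrite natrX mulrAC [M * _]mulrA ler_pdivrMr ?exprn_gt0//.
  apply: le_trans Qe; rewrite ler_wpM2l//; first by rewrite (le_trans _ M1).
  (* The two factors [Q] beyond the Lipschitz constant pay for the [2 * a] in the mesh size. *)
  rewrite (_ : Q ^+ n.+2.*2 = Q * Q * Q ^+ n.+1.*2); last first.
    by rewrite [in LHS]doubleS !exprSr -mulrA mulrC.
  rewrite ler_wpM2r ?exprn_ge0 ?(ltW Q0)//.
  by rewrite ler_pM ?(ltW a0).
move=> yz; rewrite (_ : f - _ = (f - iota (network sigma z)) +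
  (iota (network sigma z) - iota (network sigma (y (finfun k))))); last first.
  by rewrite addrA subrK.
by rewrite (le_lt_trans (ler_normD _ _))// mulr_natl mulr2n ltr_leD.
Qed.

End Covering.

(** * Base 2 logarithms and real powers *)

Section Log2.
Context {R : realType}.
Implicit Types x y s : R.

Lemma ln2_gt0 : 0 < ln 2 :> R.
Proof. by rewrite ln_gt0// ltr1n. Qed.

Lemma powR2_log2 x : 0 < x -> 2 `^ log2 x = x.
Proof.
move=> x0; rewrite /powR pnatr_eq0/= /log2 divfK ?lnK//.
by rewrite gt_eqF// ln2_gt0.
Qed.

Lemma powR_log2 x s : 0 < x -> x `^ s = 2 `^ (s * log2 x).
Proof. by move=> x0; rewrite mulrC powRrM powR2_log2. Qed.

Lemma log2_powR x s : log2 (x `^ s) = s * log2 x.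
Proof. by rewrite /log2 ln_powR mulrA. Qed.

Lemma ler_log2 x y : 0 < x -> x <= y -> log2 x <= log2 y.
Proof.
move=> x0 xy; rewrite ler_wpM2r ?invr_ge0 ?(ltW ln2_gt0)//.
by rewrite ler_ln// posrE// (lt_le_trans x0).
Qed.

Lemma log2_ge1 x : 2 <= x -> 1 <= log2 x.
Proof.
move=> x2; rewrite (le_trans _ (ler_log2 _ x2))// /log2 divff//.
by rewrite gt_eqF// ln2_gt0.
Qed.

Lemma log2_natr_le (n : nat) : log2 (n%:R : R) <= n%:R.
Proof.
case: n => [|n]; first by rewrite /log2 ln0// mul0r.
have h : (n.+1%:R : R) <= 2 `^ n.+1%:R.
  by rewrite powR_mulrn// -natrX ler_nat ltnW// ltn_expl.
rewrite (le_trans (ler_log2 _ h))// log2_powR /log2 divff ?mulr1//.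
by rewrite gt_eqF// ln2_gt0.
Qed.

(** This is [ln y < y] at [y = x ^ s], rescaled. *)
Lemma log2_le_powR x s : 0 < x -> 0 < s -> log2 x <= x `^ s / (s * ln 2).
Proof.
move=> x0 s0; rewrite ler_pdivlMr ?mulr_gt0 ?ln2_gt0//.
rewrite /log2 mulrA mulrAC divfK ?gt_eqF ?ln2_gt0// mulrC -ln_powR.
by rewrite ltW// ln_sublinear// powR_gt0.
Qed.

Lemma le_powR2 x : exists2 C, 0 <= C & x <= 2 `^ C.
Proof.
exists (Num.truncn `|x|).+1%:R => //.
rewrite powR_mulrn// -natrX (le_trans (ler_norm _))//.
by rewrite (le_trans (ltW (truncnS_gt _)))// ler_nat ltnW// ltn_expl.
Qed.

(** The ratio [y / x] lies between [gamma] and 1, so its power is largest for the exponent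
    [- |beta|], whatever the sign of [beta]. *)
Lemma powR_ratio_le (x y gamma beta : R) :
  0 < gamma -> gamma <= 1 -> 0 < x -> gamma * x <= y -> y <= x ->
  y `^ beta <= gamma `^ (- `|beta|) * x `^ beta.
Proof.
move=> g0 g1 x0 gxy yx.
have y0 : 0 < y by rewrite (lt_le_trans _ gxy)// mulr_gt0.
have -> : y = (y / x) * x by rewrite divfK// gt_eqF.
have q0 : 0 <= y / x by rewrite divr_ge0 ?ltW.
have gq : gamma <= y / x by rewrite ler_pdivlMr.
have q1 : y / x <= 1 by rewrite ler_pdivrMr ?mul1r.
rewrite powRM ?(ltW x0)// ler_wpM2r ?powR_ge0//.
apply: (@le_trans _ _ ((y / x) `^ (- `|beta|))).
  by rewrite ger_powR ?(lt_le_trans g0)// lerNl -normrN ler_norm.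
rewrite !powRN lef_pV2 ?posrE ?powR_gt0 ?(lt_le_trans g0)//.
by rewrite ge0_ler_powR ?nnegrE// ltW.
Qed.

Lemma near_powR_ge (A s : R) : 0 < s -> \forall m \near \oo, A <= m%:R `^ s.
Proof.
move=> s0; near=> m.
have mA : `|A| `^ s^-1 <= m%:R by near: m; exact: nbhs_infty_ger.
rewrite (le_trans (ler_norm _))//.
have -> : `|A| = (`|A| `^ s^-1) `^ s.
  by rewrite -powRrM mulVf ?powRr1// gt_eqF.
by rewrite ge0_ler_powR ?nnegrE ?powR_ge0// ltW.
Unshelve. all: by end_near. Qed.

End Log2.

(** * Counting bits at a given depth *)

Section Bits.
Context {R : realType} {d W : nat} {X : normedModType R}.
Variables (iota : ('cV[R]_d -> R) -> X) (sigma : R -> R) (L : R).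
Hypothesis sigma_growth : forall t r, 1 <= r -> `|t| <= r -> `|sigma t| <= r.
Hypothesis sigma_lip : forall t u, `|sigma t - sigma u| <= L * `|t - u|.
Hypothesis L_gt0 : 0 < L.
Hypothesis iota_emb : continuous_embedding iota.

Lemma doubleS_le (n : nat) : (0 < n)%N -> (n.+2.*2 <= 6 * n)%N.
Proof.
by move=> n0; rewrite -addn2 -mul2n mulnDr -[6%N]/(2 + 4)%N mulnDl leq_add2l leq_pmulr.
Qed.

(** At depth 2 each of the three blocks of parameters occurs exactly once, so [n] copies of that
    count suffice. *)
Lemma nparam_le (n : nat) : (0 < n)%N -> (nparam d W n <= n * nparam d W 2)%N.
Proof.
case: n => // n _; rewrite /nparam/= !mul1n !mulnDr.
by rewrite !leq_add ?leq_pmull ?leq_mul2r ?leqnSn ?orbT.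
Qed.

(** Here [g n] measures [log2 (w n)]. The lower bound on [e n] keeps [log2 (1 / e n)] at [O(n)], so
    that resolving the error needs no more bits per parameter than the Lipschitz constant allows
    for, namely [O(n * g n)]. *)
Lemma entropy_number_of_error (K : set X) (w g e : nat -> R) (C1 kappa c : R) :
  0 <= C1 -> 0 <= kappa -> 0 < c -> (0 < d + W)%N ->
  (\forall n \near \oo, [/\ 1 <= w n, 1 <= g n, w n <= 2 `^ (C1 * g n),
    2 `^ (- (kappa * n%:R)) <= e n &
    (class_error iota K (@network_set R d W n sigma (w n)) <= (c * e n)%:E)%E]) ->
  exists B c', [/\ 0 < B, 0 < c' & \forall n \near \oo,
    forall m : nat, B * (n%:R ^+ 2 * g n) <= m%:R ->
    (entropy_number K m <= (c' * e n)%:E)%E].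
Proof.
move=> C10 k0 c0 dW H.
have [M M1 iotaM] := continuous_embedding_lipschitz iota_emb.
pose D : R := (d + W).+1%:R * (1 + L).
have [C2 C20 DC2] := le_powR2 D.
have [C3 C30 MC3] := le_powR2 (M / (2 * c)).
(* With [Q = w n * D], the term [6 * (C1 + C2)] pays for [Q ^+ n.+2.*2], as [2 * (n + 2) <= 6 * n];
   [C3] pays for [M / (2 * c)] and [kappa] for [1 / e n]. *)
pose C4 := 6 * (C1 + C2) + C3 + kappa.
have C40 : 0 <= C4 by rewrite /C4; lra.
(* The summand 2 comes from [p.+1 <= n * g n * C4 + 2]. *)
exists ((nparam d W 2)%:R * (C4 + 2)), (2 * (2 * c)); split.
- by rewrite mulr_gt0 ?ltr_wpDl// ltr0n /nparam addnS.
- by rewrite !mulr_gt0.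
near=> n.
have [w1 g1 wg ke Ec] : [/\ 1 <= w n, 1 <= g n, w n <= 2 `^ (C1 * g n),
    2 `^ (- (kappa * n%:R)) <= e n &
    (class_error iota K (@network_set R d W n sigma (w n)) <= (c * e n)%:E)%E].
  by near: n.
have n0 : (0 < n)%N by near: n; exact: nbhs_infty_gt.
have n1 : 1 <= n%:R :> R by rewrite ler1n.
move=> m Bm.
have e0 : 0 < e n by rewrite (lt_le_trans _ ke)// powR_gt0.
have ng1 : 1 <= n%:R * g n by rewrite mulr_ege1.
pose p := (Num.truncn (n%:R * g n * C4)).+1.
have y0 : 0 <= n%:R * g n * C4 by rewrite mulr_ge0// (le_trans _ ng1).
have D2 : 2 <= D.
  by rewrite /D (@le_trans _ _ (d + W).+1%:R) ?ler_nat ?ltnS// ler_peMr// lerDl ltW.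
have D1 : 1 <= D by rewrite (le_trans _ D2)// ler1n.
(* The tolerance is [2 * c * e n], twice the known error bound, because the covering argument needs
   a strict inequality. *)
rewrite -mulrA.
apply: (@entropy_number_network _ _ _ n _ iota sigma L sigma_growth sigma_lip
  L_gt0 M M1 iotaM K (w n) (w n * D) (2 * c * e n) p m) => //.
- by rewrite (le_trans D2)// ler_peMl// (le_trans _ D1).
- by rewrite mulrA.
- by rewrite !mulr_gt0.
- have wD : w n * D <= 2 `^ ((C1 + C2) * g n).
    rewrite mulrDl powRD ?pnatr_eq0 ?implybT//.
    rewrite ler_pM ?(le_trans ler01)// (le_trans DC2)//.
    by rewrite ler_powR ?ler1n// ler_peMr.
  have wD0 : 0 <= w n * D by rewrite mulr_ge0 ?(le_trans ler01).
  have MM : M <= 2 * c * e n * 2 `^ (C3 + kappa * n%:R).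
    rewrite powRD ?pnatr_eq0 ?implybT// mulrACA.
    rewrite -[leLHS]mulr1 ler_pM ?(le_trans ler01 M1)//.
      by rewrite -ler_pdivrMl ?mulr_gt0// mulrC.
    by rewrite -ler_pdivrMr ?powR_gt0// mul1r -powRN.
  apply: (@le_trans _ _ (2 * c * e n * 2 `^ (n%:R * g n * C4))); last first.
    rewrite ler_wpM2l ?mulr_ge0 ?(ltW c0) ?(ltW e0)// -powR_mulrn//.
    by rewrite ler_powR ?ler1n// ltW// truncnS_gt.
  have QQ : (w n * D) ^+ n.+2.*2 <= 2 `^ ((C1 + C2) * g n * n.+2.*2%:R).
    by rewrite powRrM powR_mulrn ?powR_ge0// lerXn2r// nnegrE powR_ge0.
  apply: (le_trans (ler_pM _ _ MM QQ)); rewrite ?(le_trans ler01 M1) ?exprn_ge0//.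
  rewrite -[leLHS]mulrA ler_wpM2l ?mulr_ge0 ?(ltW c0) ?(ltW e0)//.
  rewrite -powRD ?pnatr_eq0 ?implybT// ler_powR ?ler1n// /C4.
  have -> : n%:R * g n * (6 * (C1 + C2) + C3 + kappa) =
    C3 * (n%:R * g n) + kappa * (n%:R * g n) + (C1 + C2) * g n * (6 * n%:R) by ring.
  rewrite lerD ?lerD//.
  + by rewrite ler_peMr.
  + by rewrite ler_wpM2l// ler_peMr// (le_trans ler01).
  + rewrite ler_wpM2l ?mulr_ge0 ?addr_ge0 ?(le_trans ler01 g1)//.
    by rewrite -natrM ler_nat doubleS_le.
- rewrite -(ler_nat R) (le_trans _ Bm)// natrM.
  apply: (@le_trans _ _ ((n * nparam d W 2)%:R * (n%:R * g n * C4 + 2))).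
    rewrite ler_pM// ?ler_nat ?nparam_le// /p -addn2 natrD.
    rewrite -natr1 -addn1 natrD -addrA lerD// truncn_le//.
  rewrite natrM -!mulrA [leLHS]mulrCA ler_wpM2l//.
  rewrite [leRHS]mulrCA ler_wpM2l// mulrDl [C4 * _]mulrC -[X in _ <= X + _]mulrA.
  by rewrite lerD2l ler_peMr.
- by rewrite (le_lt_trans Ec)// lte_fin -mulrA ltr_pMl ?ltr1n// mulr_gt0.
Unshelve. all: by end_near. Qed.

End Bits.

(** * Choosing the depth for a given number of bits *)

Section Depth.
Context {R : realType}.

(* Given m bits, [N m] is the depth to use: with B * n^2 * g n bits spent at depth
   n it stays within budget, and it is at least a multiple of the rate [r m]. The
   polynomial lower bound makes log2 (N m) comparable to log2 m. *)
Definition depth_choice (g r : nat -> R) (B a gamma : R) (N : nat -> nat) : Prop :=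
  \forall m \near \oo, [/\ m%:R `^ gamma <= (N m)%:R, (N m)%:R <= m%:R :> R,
    B * ((N m)%:R ^+ 2 * g (N m)) <= m%:R & a * r m <= (N m)%:R].

Lemma truncn_half (x : R) : 2 <= x -> x / 2 <= (Num.truncn x)%:R <= x.
Proof.
move=> x2; have x0 : 0 <= x by lra.
have := truncnS_gt x; rewrite -natr1 => h; apply/andP; split; first by lra.
by rewrite truncn_le.
Qed.

Lemma depth_choice_log2 (B : R) : 0 < B -> exists a N,
  0 < a /\ depth_choice (fun n => log2 n%:R)
    (fun m => (m%:R / log2 m%:R) `^ 2^-1) B a 8^-1 N.
Proof.
(* This [b] satisfies both [b <= 1] and [b * B <= 1], so [B * b ^+ 2 <= 1] and the budget is met. *)
move=> B0; pose b := (1 + B)^-1.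
have b0 : 0 < b by rewrite invr_gt0 addr_gt0.
have b1 : b <= 1 by rewrite invf_le1 ?addr_gt0// lerDl ltW.
have bB : b * B <= 1 by rewrite mulrC ler_pdivrMr ?addr_gt0// mul1r lerDr.
pose x m : R := b * (m%:R / log2 m%:R) `^ 2^-1.
pose k : R := 2^-1 * ln 2.
have k0 : 0 < k by rewrite mulr_gt0 ?ln2_gt0.
exists (b / 2), (fun m => Num.truncn (x m)); split; first by rewrite divr_gt0.
near=> m.
have m2 : 2 <= m%:R :> R by near: m; exact: nbhs_infty_ger.
have m0 : 0 < m%:R :> R by rewrite (lt_le_trans _ m2).
have l1 := log2_ge1 m2; have l0 : 0 < log2 m%:R :> R by rewrite (lt_le_trans _ l1).
have q0 : 0 <= m%:R / log2 m%:R :> R by rewrite divr_ge0 ?ltW.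
have xm : 2 * m%:R `^ 8^-1 <= x m.
  have -> : x m = b * (m%:R / log2 m%:R) `^ 2^-1 by [].
  have h : k * m%:R `^ 2^-1 <= m%:R / log2 m%:R.
    rewrite ler_pdivlMr// mulrAC -ler_pdivlMr ?powR_gt0//.
    have -> : m%:R / m%:R `^ 2^-1 = m%:R `^ 2^-1 :> R.
      rewrite -{1}[m%:R]powRr1 ?(ltW m0)// -powRB ?(gt_eqF m0) ?implybT//.
      by congr (_ `^ _); field.
    by rewrite mulrC -ler_pdivlMr// log2_le_powR// invr_gt0.
  have h4 : k `^ 2^-1 * m%:R `^ 4^-1 <= (m%:R / log2 m%:R) `^ 2^-1.
    have -> : m%:R `^ 4^-1 = (m%:R `^ 2^-1) `^ 2^-1 :> R.
      by rewrite -powRrM; congr (_ `^ _); field.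
    rewrite -powRM ?powR_ge0 ?(ltW k0)//.
    apply: ge0_ler_powR; rewrite ?nnegrE ?invr_ge0//.
    by rewrite mulr_ge0 ?powR_ge0// ltW.
  apply: le_trans (ler_wpM2l (ltW b0) h4).
  have -> : m%:R `^ 4^-1 = m%:R `^ 8^-1 * m%:R `^ 8^-1 :> R.
    by rewrite -powRD ?(gt_eqF m0) ?implybT//; congr (_ `^ _); field.
  rewrite !mulrA ler_wpM2r ?powR_ge0//.
  rewrite -ler_pdivrMl ?mulr_gt0 ?powR_gt0//.
  by near: m; apply: near_powR_ge; rewrite invr_gt0.
have p1 : 1 <= m%:R `^ 8^-1 :> R.
  by near: m; apply: near_powR_ge; rewrite invr_gt0.
have x2 : 2 <= x m by rewrite (le_trans _ xm)// ler_peMr.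
have /andP[Nl Nu] := truncn_half x2.
have Nm8 : m%:R `^ 8^-1 <= (Num.truncn (x m))%:R :> R.
  by rewrite (le_trans _ Nl)// ler_pdivlMr// mulrC.
have xx : x m ^+ 2 * log2 m%:R <= b ^+ 2 * m%:R.
  rewrite /x exprMn -[X in _ * X * _]powR_mulrn ?powR_ge0// -powRrM mulVf//.
  by rewrite (powRr1 q0) -mulrA divfK// gt_eqF.
have Nm : (Num.truncn (x m))%:R <= m%:R :> R.
  rewrite (le_trans Nu)// /x -[leRHS]mul1r ler_pM ?powR_ge0 ?(ltW b0)//.
  apply: (@le_trans _ _ (m%:R `^ 2^-1)).
    apply: ge0_ler_powR; rewrite ?nnegrE ?invr_ge0//.
    by rewrite ler_pdivrMr// ler_peMr.
  have m1 : 1 <= m%:R :> R by rewrite (le_trans _ m2)// ler1n.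
  by rewrite ler1_powR// invf_le1// ler1n.
split=> //; last by rewrite mulrAC.
have N0 : 0 < (Num.truncn (x m))%:R :> R by rewrite (lt_le_trans _ Nm8)// powR_gt0.
(* Replacing [log2 (N m)] by the larger [log2 m] cancels the denominator inside [x m ^+ 2]. *)
apply: (@le_trans _ _ (B * (x m ^+ 2 * log2 m%:R))).
  rewrite ler_wpM2l ?(ltW B0)// ler_pM ?sqr_ge0//.
  - by rewrite /log2 divr_ge0 ?(ltW ln2_gt0)// ln_ge0// ler1n -(ltr_nat R).
  - by rewrite lerXn2r ?nnegrE// (le_trans _ x2).
  - by rewrite ler_log2.
rewrite (le_trans (ler_wpM2l (ltW B0) xx))// mulrA ler_piMl ?(ltW m0)//.
by rewrite expr2 mulrA [B * b]mulrC -[leRHS]mul1r ler_pM ?mulr_ge0 ?(ltW b0) ?(ltW B0).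
Unshelve. all: by end_near. Qed.

(** Since [n ^ 2 * n ^ nu = n ^ (nu + 2)], the choice is a small multiple of the root of order
    [nu + 2]. The exponent [gamma] is half of [1 / (nu + 2)], which leaves a growing factor to
    absorb constants. *)
Lemma depth_choice_powR (B nu : R) : 0 < B -> 0 <= nu -> exists a N,
  0 < a /\ depth_choice (fun n => n%:R `^ nu)
    (fun m => m%:R `^ (1 / (nu + 2))) B a (2 * (nu + 2))^-1 N.
Proof.
move=> B0 nu0; pose b := (1 + B)^-1.
have b0 : 0 < b by rewrite invr_gt0 addr_gt0.
have b1 : b <= 1 by rewrite invf_le1 ?addr_gt0// lerDl ltW.
have bB : b * B <= 1 by rewrite mulrC ler_pdivrMr ?addr_gt0// mul1r lerDr.
pose x m : R := b * m%:R `^ (1 / (nu + 2)).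
have nu2 : 0 < nu + 2 by rewrite ltr_wpDl.
pose s := (2 * (nu + 2))^-1.
have s0 : 0 < s by rewrite invr_gt0 mulr_gt0.
exists (b / 2), (fun m => Num.truncn (x m)); split; first by rewrite divr_gt0.
near=> m.
have m1 : 1 <= m%:R :> R by near: m; exact: nbhs_infty_ger.
have m0 : 0 < m%:R :> R by rewrite (lt_le_trans _ m1).
have xm : 2 * m%:R `^ s <= x m.
  have -> : x m = b * (m%:R `^ s * m%:R `^ s).
    rewrite -powRD ?(gt_eqF m0) ?implybT// /x; congr (_ * _ `^ _).
    by rewrite /s; field; rewrite gt_eqF.
  rewrite !mulrA ler_wpM2r ?powR_ge0// -ler_pdivrMl//.
  by near: m; exact: near_powR_ge.
have p1 : 1 <= m%:R `^ s :> R by near: m; exact: near_powR_ge.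
have x2 : 2 <= x m by rewrite (le_trans _ xm)// ler_peMr.
have /andP[Nl Nu] := truncn_half x2.
have Nms : m%:R `^ s <= (Num.truncn (x m))%:R.
  by rewrite (le_trans _ Nl)// ler_pdivlMr// mulrC.
have N0 : 0 < (Num.truncn (x m))%:R :> R by rewrite (lt_le_trans _ Nms)// powR_gt0.
have x0 : 0 <= x m by rewrite (le_trans _ x2).
split=> //; last by rewrite mulrAC.
  rewrite (le_trans Nu)// /x -[leRHS]mul1r ler_pM ?powR_ge0 ?(ltW b0)//.
  by rewrite ler1_powR// ler_pdivrMr// mul1r; lra.
have -> : (Num.truncn (x m))%:R ^+ 2 * (Num.truncn (x m))%:R `^ nu =
    (Num.truncn (x m))%:R `^ (nu + 2) :> R.
  by rewrite -powR_mulrn// -powRD ?(gt_eqF N0) ?implybT// addrC.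
apply: (@le_trans _ _ (B * x m `^ (nu + 2))).
  by rewrite ler_wpM2l ?(ltW B0)// ge0_ler_powR ?nnegrE// ltW.
rewrite /x powRM ?powR_ge0 ?(ltW b0)// -powRrM divfK ?gt_eqF// powRr1 ?(ltW m0)//.
rewrite mulrA ler_piMl ?(ltW m0)//.
have h : b `^ (nu + 2) <= b by rewrite ge1r_powR ?b0//; lra.
by rewrite (le_trans (ler_wpM2l (ltW B0) h))// mulrC.
Unshelve. all: by end_near. Qed.

(** * From error bounds at depth [n] to rates in the number of bits *)

Section Transfer.
Variables (A : nat -> \bar R) (g r e : nat -> R) (B c a gamma : R) (N : nat -> nat).
Hypothesis c0 : 0 < c.
Hypothesis gamma0 : 0 < gamma.
Hypothesis gamma1 : gamma <= 1.
Hypothesis a0 : 0 < a.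
Hypothesis NP : depth_choice g r B a gamma N.
Hypothesis Ae : \forall n \near \oo, forall m : nat,
  B * (n%:R ^+ 2 * g n) <= m%:R -> (A m <= (c * e n)%:E)%E.

Lemma lesssim_depth_choice (b : nat -> R) (C : R) : 0 < C ->
  (\forall m \near \oo, m%:R `^ gamma <= (N m)%:R -> (N m)%:R <= m%:R :> R ->
     a * r m <= (N m)%:R -> e (N m) <= C * b m) ->
  lesssim A b.
Proof.
move=> C0 eb; exists (c * C); split; first by rewrite mulr_gt0.
(* The explicit threshold is pulled back along [N]: for large [m], [n0 <= m ^ gamma <= N m]. *)
have [n0 _ An] := Ae.
have := NP; rewrite /depth_choice => NP'.
near=> m.
have [mg Nm Bm ar] : [/\ m%:R `^ gamma <= (N m)%:R, (N m)%:R <= m%:R :> R,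
    B * ((N m)%:R ^+ 2 * g (N m)) <= m%:R & a * r m <= (N m)%:R] by near: m.
have nN : (n0 <= N m)%N.
  rewrite -(ler_nat R) (le_trans _ mg)//; near: m; exact: near_powR_ge.
apply: (le_trans (An _ nN _ Bm)).
rewrite lee_fin -mulrA ler_wpM2l ?(ltW c0)//.
have eb' : m%:R `^ gamma <= (N m)%:R -> (N m)%:R <= m%:R :> R ->
     a * r m <= (N m)%:R -> e (N m) <= C * b m by near: m.
exact: eb'.
Unshelve. all: by end_near. Qed.

(** The lower bound on [N m] is enough for the decreasing power. The logarithmic factor needs both
    bounds, [gamma * log2 m <= log2 (N m) <= log2 m], since [beta] may have either sign. *)
Lemma lesssim_powR (alpha beta : R) : 0 < alpha ->
  (forall m : nat, 2 <= m%:R :> R -> 0 < r m) ->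
  e = (fun n => log2 n%:R `^ beta * n%:R `^ (- alpha)) ->
  lesssim A (fun m => log2 m%:R `^ beta * r m `^ (- alpha)).
Proof.
move=> al0 r0 ee; apply: (@lesssim_depth_choice _
  (gamma `^ (- `|beta|) * a `^ (- alpha))); first by rewrite mulr_gt0 ?powR_gt0.
near=> m => mg Nm ar; rewrite ee.
have m2 : 2 <= m%:R :> R by near: m; exact: nbhs_infty_ger.
have m0 : 0 < m%:R :> R by rewrite (lt_le_trans _ m2).
have mg0 : 0 < m%:R `^ gamma :> R by rewrite powR_gt0.
have N0 : 0 < (N m)%:R :> R by rewrite (lt_le_trans mg0).
have ar0 : 0 < a * r m by rewrite mulr_gt0 ?r0.
rewrite mulrACA ler_pM ?powR_ge0//.
  apply: powR_ratio_le => //.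
  - by rewrite (lt_le_trans ltr01)// log2_ge1.
  - by rewrite -log2_powR ler_log2.
  - by rewrite ler_log2.
rewrite -powRM ?(ltW a0) ?(ltW (r0 _ m2))// !powRN lef_pV2 ?posrE ?powR_gt0//.
by rewrite ge0_ler_powR ?nnegrE// ltW.
Unshelve. all: by end_near. Qed.

(** For an exponential error the factor [a] lost in the depth moves into the exponent. *)
Lemma lesssim_powR2 (kappa : R) : 0 < kappa ->
  e = (fun n => 2 `^ (- (kappa * n%:R))) ->
  lesssim A (fun m => 2 `^ (- (kappa * a * r m))).
Proof.
move=> k0 ee; apply: (@lesssim_depth_choice _ 1) => //.
near=> m => mg Nm ar; rewrite ee mul1r ler_powR ?ler1n// lerN2 -mulrA.
by rewrite ler_wpM2l// ltW.
Unshelve. all: by end_near. Qed.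

End Transfer.

End Depth.

(** * Error rates, parameter bounds and activations of the four cases *)

Section Rates.
Context {R : realType}.

Lemma eq_lesssim (A : nat -> \bar R) (b b' : nat -> R) :
  (\forall n \near \oo, b n = b' n) -> lesssim A b -> lesssim A b'.
Proof.
move=> bb [c [c0 Ab]]; exists c; split=> //.
by near do rewrite -(near bb _ _)//.
Unshelve. all: by end_near. Qed.

(** Both [n] and [log2 n] are at most [2 ^ n]. This supplies the lower bound on the error required
    by the bit count, with [kappa = alpha + |beta|]. *)
Lemma powR_rate_ge (alpha beta : R) : 0 < alpha -> \forall n \near \oo,
  2 `^ (- ((alpha + `|beta|) * n%:R)) <= log2 n%:R `^ beta * n%:R `^ (- alpha).
Proof.
move=> al0; near=> n.
have n2 : 2 <= n%:R :> R by near: n; exact: nbhs_infty_ger.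
have n0 : 0 < n%:R :> R by rewrite (lt_le_trans _ n2).
have l1 := log2_ge1 n2; have l0 := lt_le_trans ltr01 l1.
have ln : log2 n%:R <= n%:R :> R := log2_natr_le n.
have n2n : n%:R <= 2 `^ n%:R :> R.
  by rewrite -{1}(powR2_log2 n0) ler_powR// ler1n.
have anti s (x y : R) : 0 < x -> x <= y -> 0 <= s -> y `^ (- s) <= x `^ (- s).
  move=> x0 xy s0; have y0 := lt_le_trans x0 xy.
  by rewrite !powRN lef_pV2 ?posrE ?powR_gt0// ge0_ler_powR ?nnegrE// ltW.
rewrite addrC mulrDl opprD powRD ?pnatr_eq0 ?implybT//.
rewrite ler_pM ?powR_ge0//; last first.
  by rewrite mulrC -mulrN powRrM anti// ltW.
apply: (@le_trans _ _ (log2 n%:R `^ (- `|beta|))).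
  by rewrite mulrC -mulrN powRrM anti// (le_trans ln).
by rewrite ler_powR// lerNl -normrN ler_norm.
Unshelve. all: by end_near. Qed.

(** The constant is absorbed by [C <= 2 ^ C0 <= 2 ^ (C0 * log2 n)]; so [g n = log2 n] is suitable
    for polynomially bounded parameters. *)
Lemma poly_bound_le (C delta : R) : 0 < delta -> exists2 C1, 0 <= C1 &
  \forall n \near \oo, C * n%:R `^ delta <= 2 `^ (C1 * log2 n%:R).
Proof.
move=> d0; have [C0 C00 CC0] := le_powR2 C.
exists (C0 + delta); first by rewrite addr_ge0// ltW.
near=> n.
have n2 : 2 <= n%:R :> R by near: n; exact: nbhs_infty_ger.
rewrite powR_log2 ?(lt_le_trans _ n2)// mulrDl powRD ?pnatr_eq0 ?implybT//.
rewrite ler_wpM2r ?powR_ge0// (le_trans CC0)// ler_powR ?ler1n//.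
by rewrite ler_peMr// log2_ge1.
Unshelve. all: by end_near. Qed.

Lemma exp_bound_le (C c' nu : R) : 0 < c' -> 0 <= nu -> exists2 C1, 0 <= C1 &
  \forall n \near \oo, C * 2 `^ (c' * n%:R `^ nu) <= 2 `^ (C1 * n%:R `^ nu).
Proof.
move=> c0 nu0; have [C0 C00 CC0] := le_powR2 C.
exists (C0 + c'); first by rewrite addr_ge0// ltW.
near=> n.
have n1 : 1 <= n%:R :> R by near: n; exact: nbhs_infty_ger.
rewrite mulrDl powRD ?pnatr_eq0 ?implybT//.
rewrite ler_wpM2r ?powR_ge0// (le_trans CC0)// ler_powR ?ler1n//.
by rewrite ler_peMr// -[leLHS](powRr0 n%:R) ler_powR.
Unshelve. all: by end_near. Qed.

Lemma near_powR_ge1 (nu : R) : 0 <= nu -> \forall n \near \oo, 1 <= n%:R `^ nu.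
Proof.
move=> nu0; near=> n.
have n1 : 1 <= n%:R :> R by near: n; exact: nbhs_infty_ger.
by rewrite -[leLHS](powRr0 n%:R) ler_powR.
Unshelve. all: by end_near. Qed.

Lemma near_log2_ge1 : \forall n \near \oo, 1 <= log2 n%:R :> R.
Proof.
by near=> n; apply: log2_ge1; near: n; exact: nbhs_infty_ger.
Unshelve. all: by end_near. Qed.

Lemma admissible_growth (L : R) (sigma : R -> R) : admissible_activation L sigma ->
  forall t r, 1 <= r -> `|t| <= r -> `|sigma t| <= r.
Proof.
move=> [[-> _]|[s1 _]] t r r1 tr; last by rewrite (le_trans (s1 t)).
rewrite /relu ger0_norm ?le_max ?lexx// ge_max (le_trans ler01 r1)/=.
by rewrite (le_trans (ler_norm _)).
Qed.

Lemma admissible_lipschitz (L : R) (sigma : R -> R) : admissible_activation L sigma ->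
  forall t u, `|sigma t - sigma u| <= L * `|t - u|.
Proof.
move=> [[-> ->]|[_ //]] t u; rewrite mul1r /relu.
(* Only ordered pairs need checking; symmetry of the distance covers the rest. *)
have H (x y : R) : y <= x -> `|Num.max 0 x - Num.max 0 y| <= `|x - y|.
  move=> yx; rewrite [leRHS]ger0_norm ?subr_ge0//.
  by case: (lerP 0 x) => x0; case: (lerP 0 y) => y0; rewrite ler_norml; lra.
by have /orP[ut|ut] := le_total u t; [|rewrite distrC [leRHS]distrC]; exact: H.
Qed.

End Rates.

Theorem corollary6p3 (R : realType) (d W : nat) (hd : (1 <= d)%N) (hW : (2 <= W)%N)
    (X : completeNormedModType R) (iota : ('cV[R]_d -> R) -> X)
    (hiota : continuous_embedding iota) (K : set X) (hK : compact K)
    (sigma : R -> R) (L : R) (hsigma : admissible_activation L sigma)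
    (w : nat -> R)
    (hw : forall n, (1 <= n)%N -> 1 <= w n /\ 2 <= L * W%:R * w n) :
  let E := fun n => class_error iota K (@network_set R d W n sigma (w n)) in
  let poly_bound := fun C delta : R =>
    forall n, (1 <= n)%N -> w n = C * n%:R `^ delta in
  let exp_bound := fun C c' nu : R =>
    forall n, (1 <= n)%N -> w n = C * 2 `^ (c' * n%:R `^ nu) in
  (forall alpha beta : R, 0 < alpha ->
     lesssim E (fun n => log2 n%:R `^ beta * n%:R `^ (- alpha)) ->
     (forall C delta : R, 0 < C -> 0 < delta -> poly_bound C delta ->
        lesssim (entropy_number K)
          (fun n => n%:R `^ (- (alpha / 2)) *
                    log2 n%:R `^ (beta + alpha / 2))) /\
     (forall C c' nu : R, 0 < C -> 0 < c' -> 0 <= nu -> exp_bound C c' nu ->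
        lesssim (entropy_number K)
          (fun n => n%:R `^ (- (alpha / (nu + 2))) * log2 n%:R `^ beta)))
  /\
  (forall c : R, 0 < c -> lesssim E (fun n => 2 `^ (- (c * n%:R))) ->
     (forall C delta : R, 0 < C -> 0 < delta -> poly_bound C delta ->
        exists c1 : R, 0 < c1 /\
        lesssim (entropy_number K)
          (fun n => 2 `^ (- (c1 * Num.sqrt n%:R / Num.sqrt (log2 n%:R))))) /\
     (forall C c' nu : R, 0 < C -> 0 < c' -> 0 <= nu -> exp_bound C c' nu ->
        exists c1 : R, 0 < c1 /\
        lesssim (entropy_number K)
          (fun n => 2 `^ (- (c1 * n%:R `^ (1 / (nu + 2))))))).
Proof.
move=> E poly_bound exp_bound.
(* Positivity of [L] follows from [2 <= L * W * w 1], the other factors being nonnegative. *)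
have L0 : 0 < L.
  have [w1 Lw] := hw 1%N isT; rewrite ltNge; apply/negP => L0.
  have : L * W%:R * w 1%N <= 0.
    by rewrite -mulrA mulr_le0_ge0// mulr_ge0// (le_trans ler01).
  by lra.
(* The bit count in the form shared by all four cases, which differ only in [g] and [e]. *)
have bits g e C1 kappa : 0 <= C1 -> 0 <= kappa ->
    (\forall n \near \oo, 1 <= g n) ->
    (\forall n \near \oo, w n <= 2 `^ (C1 * g n)) ->
    (\forall n \near \oo, 2 `^ (- (kappa * n%:R)) <= e n) -> lesssim E e ->
    exists B c, [/\ 0 < B, 0 < c & \forall n \near \oo, forall m : nat,
      B * (n%:R ^+ 2 * g n) <= m%:R -> (entropy_number K m <= (c * e n)%:E)%E].
  move=> C10 k0 g1 wg ke [c [c0 Ec]].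
  apply: (entropy_number_of_error (W := W) (w := w) (admissible_growth hsigma)
    (admissible_lipschitz hsigma) L0 hiota C10 k0 c0) => //.
    by rewrite addn_gt0 hd.
  near=> n; have n0 : (1 <= n)%N by near: n; exact: nbhs_infty_gt.
  have [w1 _] := hw n n0; split=> //.
  - by near: n.
  - by near: n.
  - by near: n.
  - by near: n; exact: Ec.
have wpoly C delta : 0 < delta -> poly_bound C delta -> exists2 C1, 0 <= C1 &
    \forall n \near \oo, w n <= 2 `^ (C1 * log2 n%:R).
  move=> d0 wC; have [C1 C10 wl] := poly_bound_le C d0; exists C1 => //.
  near=> n; rewrite wC; first by near: n.
  by near: n; exact: nbhs_infty_gt.
have wexp C c' nu : 0 < c' -> 0 <= nu -> exp_bound C c' nu -> exists2 C1, 0 <= C1 &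
    \forall n \near \oo, w n <= 2 `^ (C1 * n%:R `^ nu).
  move=> c0 nu0 wC; have [C1 C10 wl] := exp_bound_le C c0 nu0; exists C1 => //.
  near=> n; rewrite wC; first by near: n.
  by near: n; exact: nbhs_infty_gt.
have g80 : 0 < 8^-1 :> R by rewrite invr_gt0.
have g81 : 8^-1 <= 1 :> R by rewrite invf_le1// ler1n.
have gnu (nu : R) : 0 <= nu -> 0 < (2 * (nu + 2))^-1 <= 1.
  move=> nu0; have h : 1 <= 2 * (nu + 2) by lra.
  have h0 := lt_le_trans ltr01 h.
  by rewrite invr_gt0 h0 invf_le1.
split=> [alpha beta al0 EB|c c0 EB].
  have ka0 : 0 <= alpha + `|beta| by rewrite addr_ge0// ltW.
  split=> [C delta C0 d0 /(wpoly _ _ d0)[C1 C10 wl]|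
    C c' nu C0 c0 nu0 /(wexp _ _ _ c0 nu0)[C1 C10 wl]].
    have [B [c [B0 c0 entB]]] :=
      bits _ _ _ _ C10 ka0 near_log2_ge1 wl (powR_rate_ge beta al0) EB.
    have [a [N [a0 NP]]] := depth_choice_log2 B0.
    apply: eq_lesssim (lesssim_powR c0 g80 g81 a0 NP entB al0 _ erefl).
      near=> m.
      have m2 : 2 <= m%:R :> R by near: m; exact: nbhs_infty_ger.
      have l0 : 0 < log2 m%:R :> R by rewrite (lt_le_trans ltr01)// log2_ge1.
      (* The logarithm in the denominator of [m / log2 m], raised to [- alpha / 2], contributes the
         extra [alpha / 2] in the exponent of the logarithm. *)
      rewrite -powRrM mulrC mulrN [2^-1 * _]mulrC powRM ?invr_ge0 ?(ltW l0)//.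
      rewrite -mulrA; congr (_ * _).
      rewrite -[(log2 m%:R)^-1]powR_inv1 ?(ltW l0)// -powRrM mulN1r opprK.
      by rewrite -powRD ?(gt_eqF l0) ?implybT// addrC.
    move=> m m2; rewrite powR_gt0// divr_gt0 ?(lt_le_trans _ m2)//.
    by rewrite (lt_le_trans ltr01)// log2_ge1.
  have [B [c [B0 c1 entB]]] :=
    bits _ _ _ _ C10 ka0 (near_powR_ge1 nu0) wl (powR_rate_ge beta al0) EB.
  have [a [N [a0 NP]]] := depth_choice_powR B0 nu0.
  have /andP[s0 s1] := gnu _ nu0.
  apply: eq_lesssim (lesssim_powR c1 s0 s1 a0 NP entB al0 _ erefl).
    near=> m.
    by rewrite -powRrM mulrC mulrN mul1r [_^-1 * _]mulrC.
  by move=> m m2; rewrite powR_gt0// (lt_le_trans _ m2).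
(* An exponential error is its own lower bound, with [kappa = c]. *)
have eC : \forall n \near \oo, 2 `^ (- (c * n%:R)) <= 2 `^ (- (c * n%:R)) :> R.
  by near=> n.
split=> [C delta C0 d0 /(wpoly _ _ d0)[C1 C10 wl]|
    C c' nu C0 c1 nu0 /(wexp _ _ _ c1 nu0)[C1 C10 wl]].
  have [B [c2 [B0 c20 entB]]] := bits _ _ _ _ C10 (ltW c0) near_log2_ge1 wl eC EB.
  have [a [N [a0 NP]]] := depth_choice_log2 B0.
  exists (c * a); split; first by rewrite mulr_gt0.
  apply: eq_lesssim (lesssim_powR2 c20 g80 NP entB c0 erefl).
  near=> m.
  have m2 : 2 <= m%:R :> R by near: m; exact: nbhs_infty_ger.
  have l0 : 0 < log2 m%:R :> R by rewrite (lt_le_trans ltr01)// log2_ge1.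
  have q0 : 0 <= m%:R / log2 m%:R :> R by rewrite divr_ge0// ltW.
  by rewrite powR12_sqrt// sqrtrM// sqrtrV ?(ltW l0)// mulrA.
have [B [c2 [B0 c20 entB]]] := bits _ _ _ _ C10 (ltW c0) (near_powR_ge1 nu0) wl eC EB.
have [a [N [a0 NP]]] := depth_choice_powR B0 nu0.
have /andP[s0 s1] := gnu _ nu0.
exists (c * a); split; first by rewrite mulr_gt0.
exact: (lesssim_powR2 c20 s0 NP entB c0 erefl).
Unshelve. all: by end_near. Qed.
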